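(* Let $d\ge 2$ and $r\in\mathbb{N}\setminus\{1,2,4\}$. Let $M:\Delta_{X_r}\to\mathbb{R}$ be a Markov cocycle. Then there exists a nearest neighbor interaction $\phi$ on $X_r$, not necessarily shift-invariant, such that $M=M_\phi$. (That is, $\mathcal{M}_{X_r}=\mathcal{G}_{X_r}$.)
   Context: $\mathbb{Z}^d$ is regarded as the vertex set of the graph in which $n,m$ are adjacent iff $\|n-m\|_1=1$. For $F\subset\mathbb{Z}^d$, $\partial F$ is the set of sites outside $F$ adjacent to some site of $F$. The space $X_r$: $Ht=\{\hat x\in\mathbb{Z}^{\mathbb{Z}^d}: |\hat x_n-\hat x_m|=1 \text{ whenever } \|n-m\|_1=1\}$; $\phi_r:Ht\to(\mathbb{Z}_r)^{\mathbb{Z}^d}$, $\mathbb{Z}_r=\mathbb{Z}/r\mathbb{Z}$, is coordinatewise reduction modulo $r$; and $X_r=\phi_r(Ht)$. For $X\subset\mathcal{A}^{\mathbb{Z}^d}$, $\Delta_X$ is the set of pairs $(x,y)\in X\times X$ with $x_n=y_n$ for all but finitely many $n$. A $\Delta_X$-cocycle is a function $M:\Delta_X\to\mathbb{R}$ with $M(x,z)=M(x,y)+M(y,z)$ whenever $(x,y),(y,z)\in\Delta_X$. It is a Markov cocycle if, for every finite $F$ and all $(x,y)\in\Delta_X$ with $x|_{F^c}=y|_{F^c}$, the value $M(x,y)$ is determined by $x|_{F\cup\partial F}$ and $y|_{F\cup\partial F}$. $\mathcal{M}_X$ denotes the vector space of Markov cocycles on $X$. $\mathcal{B}(X)$ is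 the set of all patterns $x|_W$ with $x\in X$, $W\subset\mathbb{Z}^d$ finite. A nearest neighbor interaction on $X$ is a function $\phi:\mathcal{B}(X)\to\mathbb{R}$ with $\phi(a)=0$ whenever the set on which $a$ is defined has diameter greater than $1$ in the graph distance. The associated Gibbs cocycle is $M_\phi(x,y)=\sum_{W\subset\mathbb{Z}^d\text{ finite}}\big(\phi(y|_W)-\phi(x|_W)\big)$ for $(x,y)\in\Delta_X$ (only finitely many terms are nonzero). $\mathcal{G}_X$ denotes the set of all $M_\phi$ with $\phi$ a nearest neighbor interaction. *)

(* Defs.v *)
From HB Require Import structures.
From mathcomp Require Import all_boot all_order all_algebra finmap.
From mathcomp Require Import mathcomp_extra boolp classical_sets functions
  cardinality fsbigop reals.

Set Implicit Arguments.
Unset Strict Implicit.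
Unset Printing Implicit Defensive.

Import Order.TTheory GRing.Theory Num.Theory.
Local Open Scope classical_set_scope.
Local Open Scope ring_scope.

Notation site d := 'rV[int]_d.

Definition l1norm (d : nat) (n : site d) : int := \sum_(i < d) `|n 0 i|.

Definition adjacent (d : nat) : rel (site d) := fun n m => l1norm (n - m) == 1.

Definition boundary (d : nat) (F : {fset site d}) : set (site d) :=
  [set m | m \notin F /\ exists2 n, n \in F & adjacent n m].

Definition graph_dist_le (d k : nat) (n m : site d) : Prop :=
  exists p : seq (site d),
    [/\ path (@adjacent d) n p, last n p = m & (size p <= k)%N].

Definition diam_le (d k : nat) (W : {fset site d}) : Prop :=
  forall n m, n \in W -> m \in W -> graph_dist_le k n m.

Definition height_functions (d : nat) : set (site d -> int) :=
  [set h | forall n m, adjacent n m -> `|h n - h m| = 1].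

(* 'Z_r is Z/rZ only for r > 1: 'Z_0 and 'Z_1 both denote Z/2Z. *)
Definition reduce (d r : nat) (h : site d -> int) : site d -> 'Z_r :=
  fun n => (h n)%:~R.

Definition Xspace (d r : nat) : set (site d -> 'Z_r) :=
  @reduce d r @` @height_functions d.

Section Cocycles.
Variables (R : realType) (d : nat) (A : choiceType).
Implicit Types (X : set (site d -> A)) (x y : site d -> A).

Definition Delta X : set ((site d -> A) * (site d -> A)) :=
  [set xy | [/\ X xy.1, X xy.2 & finite_set [set n | xy.1 n <> xy.2 n]]].

Definition agree_on (S : set (site d)) x y : Prop :=
  forall n, S n -> x n = y n.

(* Functions on Delta X (resp. on the patterns of X) are encoded as total
   functions; their values elsewhere are neither constrained nor used. *)
Definition cocycle X (M : (site d -> A) * (site d -> A) -> R) : Prop :=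
  forall x y z, Delta X (x, y) -> Delta X (y, z) ->
    M (x, z) = M (x, y) + M (y, z).

Definition markov_cocycle X (M : (site d -> A) * (site d -> A) -> R) : Prop :=
  cocycle X M /\
  forall (F : {fset site d}) x y x' y',
    Delta X (x, y) -> Delta X (x', y') ->
    agree_on (~` [set` F]) x y -> agree_on (~` [set` F]) x' y' ->
    agree_on ([set` F] `|` boundary F) x x' ->
    agree_on ([set` F] `|` boundary F) y y' ->
    M (x, y) = M (x', y').

Definition restrict x (W : {fset site d}) : {fmap site d -> A} :=
  [fmap n : W => x (val n)].

Definition patterns X : set {fmap site d -> A} :=
  [set a | exists x W, X x /\ a = restrict x W].

Definition nn_interaction X (phi : {fmap site d -> A} -> R) : Prop :=
  forall a, patterns X a -> ~ diam_le 1 (domf a) -> phi a = 0.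

(* The sum ranges over all finite W; \sum_(_ \in _) is the sum over the support
   of the summand, which is finite on Delta X for a nearest neighbor phi. *)
Definition gibbs_cocycle (phi : {fmap site d -> A} -> R)
    (xy : (site d -> A) * (site d -> A)) : R :=
  \sum_(W \in [set: {fset site d}])
    (phi (restrict xy.2 W) - phi (restrict xy.1 W)).

End Cocycles.

(* Main.v *)
Require Import Defs.
From HB Require Import structures.
From mathcomp Require Import all_boot all_order all_algebra finmap.
From mathcomp Require Import mathcomp_extra boolp classical_sets functions
  cardinality fsbigop reals.
From mathcomp Require Import zify ring.

Set Implicit Arguments.
Unset Strict Implicit.
Unset Printing Implicit Defensive.

(* [restrict] denotes the pattern of a configuration, not the operator
   on functions of the same name. *)
Import Defs.
Import Order.TTheory GRing.Theory Num.Theory.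
Local Open Scope classical_set_scope.
Local Open Scope ring_scope.

(** Two configurations of X_r that differ at finitely many sites are reductions
    of height functions that differ at finitely many sites ([lift_pair]), and
    such height functions are joined by a chain of pivots, each raising or
    lowering one height by 2 ([pivot_induction]).  A cocycle is therefore
    determined by its values on pivots.

    At a pivot at site n all the neighbours of n carry a common value a, and the
    value at n passes from a - 1 to a + 1.  The Markov property makes the value of
    M there a function c n a of n and a alone ([pivot_value]).  Conversely every
    function c comes from an interaction.  Fix a coordinate direction e and let
    the interaction of the edge (n, n + e) be u n a if its ends carry a and a + 1,
    in this order, and 0 otherwise.  As a - 1 and a + 1 differ in Z/r, the pivot
    creates one such edge, (n - e, n), and destroys one, (n, n + e), so that its
    Gibbs cocycle is u (n - e) a - u n (a - 1).  The equation
    u (n - e) a - u n (a - 1) = c n a is a first-order recurrence along each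
    diagonal of a lattice line parallel to e times Z/r; it has no boundary
    condition, so it is solvable ([edge_potential]).  The interaction obtained
    in this way need not be shift-invariant even if M is.

    That Gibbs cocycles are Markov ([gibbs_markov]) holds over any alphabet: a set
    of diameter at most 1 that meets F lies in F and its boundary. *)

(** * The lattice *)

Definition unit_vec (d : nat) (j : 'I_d) : site d := delta_mx 0 j.

Lemma unit_vecE (d : nat) (j i : 'I_d) : unit_vec j 0 i = (i == j)%:R.
Proof. by rewrite mxE eqxx. Qed.

Lemma l1norm_unit_vec (d : nat) (j : 'I_d) : l1norm (unit_vec j) = 1.
Proof.
rewrite /l1norm (bigD1 j) //= unit_vecE eqxx big1 ?addr0 ?normr1 // => i ne_ij.
by rewrite unit_vecE (negbTE ne_ij) normr0.
Qed.

Lemma l1normN (d : nat) (v : site d) : l1norm (- v) = l1norm v.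
Proof. by apply: eq_bigr => i _; rewrite mxE normrN. Qed.

Lemma le_coord_l1norm (d : nat) (v : site d) i : `|v 0 i| <= l1norm v.
Proof. by rewrite /l1norm (bigD1 i) //= lerDl sumr_ge0. Qed.

Lemma adjacent_sym (d : nat) (n m : site d) : adjacent n m = adjacent m n.
Proof. by rewrite /adjacent -l1normN opprB. Qed.

Lemma adjacentxx (d : nat) (n : site d) : adjacent n n = false.
Proof.
by rewrite /adjacent subrr /l1norm big1 // => i _; rewrite mxE normr0.
Qed.

Lemma adjacent_unit_vec (d : nat) (n : site d) j : adjacent n (n + unit_vec j).
Proof.
by rewrite adjacent_sym /adjacent addrAC subrr add0r l1norm_unit_vec.
Qed.

Definition outside (d : nat) (N : int) (p : site d) : Prop :=
  exists i, N < `|p 0 i|.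

Lemma exists_outside (d : nat) (N : int) :
  (0 < d)%N -> exists p : site d, outside N p.
Proof.
by move=> d0; exists (const_mx (`|N| + 1)), (Ordinal d0); rewrite mxE; lia.
Qed.

Lemma finite_box (d : nat) (N : int) :
  finite_set [set p : site d | ~ outside N p].
Proof.
pose B := `|N|%N.
(* The point of the box whose coordinates, shifted by B, are the entries of w. *)
pose center (w : 'rV['I_(2 * B).+1]_d) : site d :=
  map_mx (fun k : 'I_(2 * B).+1 => (k : nat)%:Z - B%:Z) w.
apply: (sub_finite_set (B := range center)); last first.
  by apply: finite_image; exact: (@finite_finset _ setT).
move=> p /= pN.
exists (\row_(i < d) (inord `|(p 0%R i + B%:Z)%R|%N : 'I_(2 * B).+1)) => //.
apply/rowP => i; have : ~ N < `|p 0 i| by move=> Np; apply: pN; exists i.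
by rewrite !mxE /B; move: (p 0 i) => a aN; rewrite inordK; lia.
Qed.

Lemma finite_neighbors (d : nat) (n : site d) :
  finite_set [set m | adjacent n m].
Proof.
apply: (sub_finite_set (B := (fun v => n - v) @` [set v | ~ outside 1 v])).
  move=> m /= /eqP nm; exists (n - m); last by rewrite opprB addrC subrK.
  by case=> i; apply/negP; rewrite -leNgt -nm le_coord_l1norm.
by apply: finite_image; apply: finite_box.
Qed.

Lemma finite_bounded (d : nat) (S : set (site d)) :
  finite_set S -> exists N, forall p, S p -> ~ outside N p.
Proof.
move=> /finite_fsetP[D ->]; exists (\sum_(p : D) l1norm (val p)).
move=> p /= pD [i]; apply/negP; rewrite -leNgt.
apply: le_trans (le_coord_l1norm p i) _.
rewrite (bigD1 [` pD]%fset) //= lerDl; apply: sumr_ge0 => q _.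
by apply: sumr_ge0.
Qed.

Lemma int_const (T : Type) (f : int -> T) :
  (forall t, f (t + 1) = f t) -> forall t, f t = f 0.
Proof.
move=> fS; elim/int_ind => [//|n IH|n IH].
  by rewrite -IH -(fS n); congr f; lia.
by rewrite -IH -(fS (- n.+1%:Z)); congr f; lia.
Qed.

Definition set_coord (d : nat) (p : site d) (j : 'I_d) (b : int) : site d :=
  p + (b - p 0 j) *: unit_vec j.

Lemma set_coordE (d : nat) (p : site d) j b i :
  set_coord p j b 0 i = if i == j then b else p 0 i.
Proof.
rewrite !mxE eqxx; case: (eqVneq i j) => [->|_] /=; last by rewrite mulr0 addr0.
by rewrite mulr1 addrC subrK.
Qed.

(** The complement of a box is connected when d >= 2: while one coordinate i is
    large, every other coordinate can be moved freely; once another one has become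
    large, coordinate i can be moved as well. *)
Lemma outside_const (d : nat) (T : Type) (f : site d -> T) (N : int) :
    (2 <= d)%N ->
    (forall p j, outside N p -> outside N (p + unit_vec j) ->
       f (p + unit_vec j) = f p) ->
  forall p q, outside N p -> outside N q -> f p = f q.
Proof.
move=> d2 fN.
have f_line (p : site d) i j b : i != j -> N < `|p 0 i| -> f (set_coord p j b) = f p.
  move=> ne_ij pi.
  have out t : outside N (p + t *: unit_vec j).
    by exists i; rewrite !mxE (negbTE ne_ij) /= mulr0 addr0.
  rewrite /set_coord (@int_const _ (fun t => f (p + t *: unit_vec j))).
    by rewrite scale0r addr0.
  move=> t; rewrite scalerDl scale1r addrA fN // -addrA.
  by rewrite -{2}[unit_vec j]scale1r -scalerDl.
(* Every point outside is joined to the constant vector b. *)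
pose b : int := `|N| + 1.
have bN : N < `|b| by rewrite /b; lia.
suff f_base p : outside N p -> f p = f (const_mx b).
  by move=> p q /f_base -> /f_base ->.
case=> i pi.
(* Coordinates other than i are set to b one at a time. *)
pose fill (s : seq 'I_d) : site d := \row_k if k \in s then b else p 0 k.
have f_fill s : i \notin s -> f (fill s) = f p.
  elim: s => [_|j s IH]; first by congr f; apply/rowP => k; rewrite mxE.
  rewrite inE negb_or => /andP[ne_ij i_s].
  rewrite -IH // -(@f_line (fill s) i j b) //; last by rewrite mxE (negbTE i_s).
  by congr f; apply/rowP => k; rewrite set_coordE !mxE inE; case: eqP.
(* Coordinate i comes last, and j keeps the path outside the box. *)
have [j ne_ji] : exists j : 'I_d, j != i.
  pose k0 := Ordinal (ltnW d2); pose k1 := Ordinal d2.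
  by case: (eqVneq i k0) => [->|ne]; [exists k1 | exists k0; rewrite eq_sym].
pose s := [seq k <- enum 'I_d | k != i].
have sE k : (k \in s) = (k != i) by rewrite mem_filter mem_enum andbT.
rewrite -(f_fill s) ?sE ?eqxx //.
rewrite -(@f_line (fill s) j i b) //; last by rewrite mxE sE ne_ji.
congr f; apply/rowP => k; rewrite set_coordE !mxE sE.
by case: (k == i).
Qed.

(** * Height functions and pivots *)

Lemma finite_diff_fset (T : choiceType) (U : Type) (f g : T -> U) :
    finite_set [set n | f n <> g n] ->
  exists D : {fset T}, forall n, n \notin D -> f n = g n.
Proof.
move=> /finite_fsetP[D eqD]; exists D => n nD; apply: contrapT => neq.
by case/negP: nD; move: (neq : [set n | f n <> g n] n); rewrite eqD.
Qed.

Lemma height_step (d : nat) (h : site d -> int) n m :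
  height_functions h -> adjacent n m -> h n = h m + 1 \/ h n = h m - 1.
Proof. by move=> hh /hh; lia. Qed.

Lemma two_neq0 (r : nat) : (2 < r)%N -> (1 + 1 : 'Z_r) != 0.
Proof.
move=> r2; rewrite -mulr2n; apply/eqP => /(congr1 (@nat_of_ord _)).
by rewrite val_Zp_nat ?(ltnW r2) // modn_small.
Qed.

(** Where the reductions agree on an edge, the increments of h and g along it are
    both 1 or -1 and congruent modulo r > 2, hence equal.  So h - g is constant
    outside a box; g' is g plus this constant, which reduces to 0. *)
Lemma lift_pair (d r : nat) (h g : site d -> int) :
    (2 <= d)%N -> (2 < r)%N ->
    height_functions h -> height_functions g ->
    finite_set [set n | reduce r h n <> reduce r g n] ->
  exists g', [/\ height_functions g', reduce r g' = reduce r g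
               & finite_set [set n | h n <> g' n]].
Proof.
move=> d2 r2 hh hg /finite_bounded[N fin].
have eq_out p : outside N p -> reduce r h p = reduce r g p.
  by move=> pN; apply: contrapT => /fin.
have [q qN] := exists_outside N (ltnW d2).
have f_const p : outside N p -> h p - g p = h q - g q.
  move=> pN; apply: (@outside_const _ _ (fun n => h n - g n) N) => // {}p j {}pN pjN.
  have := eq_out _ pN; have := eq_out _ pjN; rewrite /reduce.
  have pj := adjacent_unit_vec p j.
  have := height_step hh pj; have := height_step hg pj.
  move: (h p) (g p) (h (p + _)) (g (p + _)) => a b a' b'.
  move=> g_step h_step /eqP ab' /eqP ab.
  rewrite -subr_eq0 -rmorphB in ab; rewrite -subr_eq0 -rmorphB in ab'.
  have two_neq0Z : (2%:~R : 'Z_r) != 0.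
    by rewrite -[2]/(1 + 1) rmorphD two_neq0.
  have : ((a - b) - (a' - b'))%:~R == 0 :> 'Z_r.
    by rewrite rmorphB /= (eqP ab) (eqP ab') subrr.
  have [eq0|[->|->]] : (a - b) - (a' - b') = 0 \/ (a - b) - (a' - b') = 2 \/
      (a - b) - (a' - b') = - 2 by lia.
  - by lia.
  - by rewrite (negbTE two_neq0Z).
  - by rewrite rmorphN oppr_eq0 (negbTE two_neq0Z).
exists (fun n => g n + (h q - g q)); split.
- by move=> n m /hg <-; rewrite opprD addrACA subrr addr0.
- apply/funext => n; rewrite /reduce rmorphD rmorphB /=.
  by have := eq_out _ qN; rewrite /reduce => ->; rewrite subrr addr0.
- apply: sub_finite_set (finite_box d N) => n /= neq /f_const eq_n.
  by apply: neq; rewrite -eq_n addrC subrK.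
Qed.

(** Along an edge h - g changes by 0 or by 2 in absolute value, and it vanishes far
    away. *)
Lemma height_parity (d : nat) (h g : site d -> int) :
    (2 <= d)%N -> height_functions h -> height_functions g ->
    finite_set [set n | h n <> g n] ->
  forall n, (2 %| h n - g n)%Z.
Proof.
move=> d2 hh hg /finite_bounded[N fin] n.
have [q qN] := exists_outside N (ltnW d2).
have eq_q : h q = g q by apply: contrapT => /fin.
have d0 := ltnW d2.
have out (p : site d) : outside (-1) p by exists (Ordinal d0); lia.
(* For N = -1 the box is empty, so its complement is the whole lattice. *)
rewrite (@outside_const _ _ (fun n => (2 %| h n - g n)%Z) (-1) d2 _ n q) //.
  by rewrite eq_q subrr dvdz0.
move=> p j _ _; have pj := adjacent_unit_vec p j.
have := height_step hh pj; have := height_step hg pj.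
move: (h p) (g p) (h (p + _)) (g (p + _)) => a b a' b'; lia.
Qed.

Definition raise (d : nat) (h : site d -> int) (n : site d) : site d -> int :=
  fun m => if m == n then h m + 2 else h m.

(** Take m of minimal height among the sites where h < g.  A neighbour k with
    h k = h m - 1 would, by minimality, satisfy g k <= h k < h m, whereas g m is at
    least h m + 2 by parity and g k is at least g m - 1. *)
Lemma exists_pivot (d : nat) (h g : site d -> int) (n : site d) :
    (2 <= d)%N -> height_functions h -> height_functions g ->
    finite_set [set n | h n <> g n] -> h n < g n ->
  exists m, [/\ h m + 2 <= g m & forall k, adjacent m k -> h k = h m + 1].
Proof.
move=> d2 hh hg fin lt_n; have par := height_parity d2 hh hg fin.
have [D off] := finite_diff_fset fin.
have nD : n \in D.
  by apply: contraPT lt_n => /off ->; rewrite ltxx.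
case: (@arg_minP _ _ _ [` nD]%fset (fun m : D => h (val m) < g (val m))
         (fun m : D => h (val m)) lt_n) => [[m mD] /= lt_m min_m].
exists m; split; first by have := par m; lia.
move=> k mk; case: (height_step hh mk) => [h_k|h_k]; last by lia.
suff : h k < g k.
  move=> lt_k; have kD : k \in D by apply: contraPT lt_k => /off ->; rewrite ltxx.
  by have := min_m [` kD]%fset lt_k; rewrite /= h_k; lia.
by have := par m; have := height_step hg mk; lia.
Qed.

Lemma raise_height (d : nat) (h : site d -> int) (m : site d) :
    height_functions h -> (forall k, adjacent m k -> h k = h m + 1) ->
  height_functions (raise h m).
Proof.
move=> hh pivot k l kl; rewrite /raise.
case: (eqVneq k m) (eqVneq l m) => [->|km] [->|lm] in kl *.
- by rewrite adjacentxx in kl.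
- by rewrite (pivot _ kl); lia.
- by rewrite adjacent_sym in kl; rewrite (pivot _ kl); lia.
- exact: hh.
Qed.

(** Induction on the total distance between h and g: exchanging them if needed, h
    is below g somewhere, and the pivot of [exists_pivot] brings h closer to g. *)
Lemma pivot_induction (d : nat) (P : (site d -> int) -> (site d -> int) -> Prop) :
    (2 <= d)%N ->
    (forall h, height_functions h -> P h h) ->
    (forall h g, P h g -> P g h) ->
    (forall h g f, P h g -> P g f -> P h f) ->
    (forall h m, height_functions h ->
       (forall k, adjacent m k -> h k = h m + 1) -> P h (raise h m)) ->
  forall h g, height_functions h -> height_functions g ->
    finite_set [set n | h n <> g n] -> P h g.
Proof.
move=> d2 Prefl Psym Ptrans Praise h g hh hg fin.
have [D off] := finite_diff_fset fin.
have [k] := ubnP (\sum_(n : D) `|h (val n) - g (val n)|)%N.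
elim: k => // k IH in h g hh hg off {fin} *.
have fin : finite_set [set n | h n <> g n].
  apply: sub_finite_set (finite_fset D) => n /= neq.
  by apply: contrapT => /negP /off.
wlog [n lt_n] : h g hh hg off fin / exists n, h n < g n.
  move=> wlog_lt meas.
  have [ex_lt|no_lt] := pselect (exists n, h n < g n); first exact: wlog_lt.
  have [ex_gt|no_gt] := pselect (exists n, g n < h n).
    apply: Psym; apply: wlog_lt => //; first by move=> m /off.
      by apply: sub_finite_set fin => n /= neq eq_n; apply: neq.
    by under eq_bigr do rewrite distnC.
  suff -> : h = g by exact: Prefl.
  by apply/funext => n; case: (ltgtP (h n) (g n)) => // ?;
    [case: no_lt | case: no_gt]; exists n.
have [m [gap pivot]] := exists_pivot d2 hh hg fin lt_n.
rewrite ltnS => meas; apply: (Ptrans _ (raise h m)); first exact: Praise.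
have mD : m \in D by apply: contraTT gap => /off ->; lia.
apply: IH => //; first exact: raise_height.
  move=> l lD; rewrite /raise; case: eqVneq lD => [->|_]; last exact: off.
  by rewrite mD.
apply: leq_trans meas.
rewrite (bigD1 [` mD]%fset) //= [X in (_ < X)%N](bigD1 [` mD]%fset) //=.
rewrite /raise eqxx -addSn leq_add //; first by lia.
apply: leq_sum => l ne_l; case: eqP => // eq_l.
by case/eqP: ne_l; apply: val_inj.
Qed.


(** * Gibbs cocycles *)

Lemma Delta_sym (d : nat) (A : choiceType) (X : set (site d -> A)) x y :
  Delta X (x, y) -> Delta X (y, x).
Proof.
case=> /= Xx Xy fin; split=> //=.
by apply: sub_finite_set fin => n /= neq eq_n; apply: neq.
Qed.

Lemma Delta_trans (d : nat) (A : choiceType) (X : set (site d -> A)) x y z :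
  Delta X (x, y) -> Delta X (y, z) -> Delta X (x, z).
Proof.
case=> /= Xx _ fin_xy [/= _ Xz fin_yz]; split=> //=.
apply: sub_finite_set (_ : finite_set ([set n | x n <> y n] `|` [set n | y n <> z n])).
  move=> n /= neq; have [eq_xy|] := pselect (x n = y n); last by left.
  by right; rewrite -eq_xy.
by rewrite finite_setU.
Qed.

Lemma cocycle_refl (R : realType) (d : nat) (A : choiceType)
    (X : set (site d -> A)) (M : (site d -> A) * (site d -> A) -> R) x :
  cocycle X M -> Delta X (x, x) -> M (x, x) = 0.
Proof. by move=> cM xx; apply: (addrI (M (x, x))); rewrite -cM // addr0. Qed.

Lemma cocycle_sym (R : realType) (d : nat) (A : choiceType)
    (X : set (site d -> A)) (M : (site d -> A) * (site d -> A) -> R) x y :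
  cocycle X M -> Delta X (x, y) -> M (y, x) = - M (x, y).
Proof.
move=> cM xy; have yx := Delta_sym xy.
apply/eqP; rewrite -addr_eq0 -cM // (cocycle_refl cM) //.
exact: Delta_trans yx xy.
Qed.

Lemma diam_le1_adjacent (d : nat) (W : {fset site d}) n m :
  diam_le 1 W -> n \in W -> m \in W -> m = n \/ adjacent n m.
Proof.
move=> diamW nW mW; have [[|k [|l p]] [/= path_p last_p size_p]] := diamW n m nW mW.
- by left.
- by right; rewrite -last_p; case/andP: path_p.
- by [].
Qed.

Lemma restrict_agree (d : nat) (A : choiceType) (x y : site d -> A)
    (W : {fset site d}) :
  agree_on [set` W] x y -> restrict x W = restrict y W.
Proof.
move=> xy; rewrite /restrict; congr FinMap; apply/ffunP => n.
by rewrite !ffunE; apply: xy => /=; apply: valP.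
Qed.

Lemma nn_interaction0 (R : realType) (d : nat) (A : choiceType)
    (X : set (site d -> A)) (phi : {fmap site d -> A} -> R) x W :
  nn_interaction X phi -> X x -> ~ diam_le 1 W -> phi (restrict x W) = 0.
Proof. by move=> nn Xx; apply: nn; exists x, W. Qed.

(** A set of diameter at most 1 that contains a site where x and y differ consists
    of that site and some of its neighbours. *)
Lemma gibbs_term_support (R : realType) (d : nat) (A : choiceType)
    (X : set (site d -> A)) (phi : {fmap site d -> A} -> R) x y :
    nn_interaction X phi -> Delta X (x, y) ->
  exists S : {fset {fset site d}}, forall W, W \notin S ->
    phi (restrict y W) - phi (restrict x W) = 0.
Proof.
move=> nn [/= Xx Xy /finite_diff_fset[D off]].
have /finite_fsetP[B eqB] :
    finite_set (\bigcup_(n in [set` D]) ([set n] `|` [set m | adjacent n m])).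
  apply: bigcup_finite => // n _; rewrite finite_setU; split=> //.
  exact: finite_neighbors.
exists (fpowerset B) => W; rewrite fpowersetE => WB.
have [diamW|?] := pselect (diam_le 1 W); last first.
  by rewrite !(nn_interaction0 nn) // subrr.
suff -> : restrict y W = restrict x W by rewrite subrr.
apply: restrict_agree => n /= nW; apply/esym/off.
apply: contra WB => nD; apply/fsubsetP => m mW.
suff : [set` B] m by [].
by rewrite -eqB; exists n => //; have [->|] := diam_le1_adjacent diamW nW mW;
  [left | right].
Qed.

(** The interaction sees a set W of diameter at most 1 only.  If W meets F then it
    lies in F and its boundary, where the two pairs have the same patterns;
    otherwise each pair has a single pattern on W, and the terms vanish. *)
Lemma gibbs_markov (R : realType) (d : nat) (A : choiceType)
    (X : set (site d -> A)) (phi : {fmap site d -> A} -> R) :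
  nn_interaction X phi -> markov_cocycle X (gibbs_cocycle phi).
Proof.
move=> nn; split=> [x y z xy yz|F x y x' y' xy xy' F_xy F_xy' xx' yy'].
  have [S Sxy] := gibbs_term_support nn xy.
  have [T Tyz] := gibbs_term_support nn yz.
  rewrite /gibbs_cocycle /=.
  rewrite !(@fsbigTE _ _ _ _ (S `|` T)%fset) -?big_split /=.
  - by apply: eq_bigr => W _; rewrite addrC subrKA.
  - by move=> W; rewrite in_fsetU negb_or => /andP[_ /Tyz].
  - by move=> W; rewrite in_fsetU negb_or => /andP[/Sxy].
  - move=> W; rewrite in_fsetU negb_or => /andP[/Sxy SW /Tyz TW].
    by rewrite -[LHS](subrKA (phi (restrict y W))) SW TW addr0.
case: xy xy' => /= Xx Xy _ [/= Xx' Xy' _].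
apply: eq_fsbigr => W _ /=.
have [diamW|?] := pselect (diam_le 1 W); last by rewrite !(nn_interaction0 nn).
have [[n nW nF]|disj] := pselect (exists2 n, n \in W & n \in F).
  have WF : [set` W] `<=` [set` F] `|` boundary F.
    move=> m /= mW; have [mF|mF] := boolP (m \in F); first by left.
    right; split=> //; exists n => //.
    by have [eq_mn|//] := diam_le1_adjacent diamW nW mW; rewrite eq_mn nF in mF.
  have -> : restrict x W = restrict x' W by apply: restrict_agree => m /WF /xx'.
  by have -> : restrict y W = restrict y' W by apply: restrict_agree => m /WF /yy'.
have WF m : [set` W] m -> (~` [set` F]) m by move=> mW mF; apply: disj; exists m.
have -> : restrict y W = restrict x W by apply: restrict_agree => m /WF /F_xy.
have -> : restrict y' W = restrict x' W by apply: restrict_agree => m /WF /F_xy'.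
by rewrite !subrr.
Qed.

Definition edge (d : nat) (j : 'I_d) (n : site d) : {fset site d} :=
  [fset n; (n + unit_vec j)%R]%fset.

Lemma unit_vec_neq0 (d : nat) (j : 'I_d) (k : nat) :
  (0 < k)%N -> unit_vec j *+ k != 0.
Proof.
move=> k0; apply/eqP => /matrixP/(_ 0 j); rewrite mulmxnE unit_vecE eqxx mxE.
by lia.
Qed.

(** An edge in direction j determines its lower end because n + 2 e_j <> n. *)
Lemma edge_inj (d : nat) (j : 'I_d) : injective (edge j).
Proof.
move=> n m eq_nm.
have : n \in edge j m by rewrite -eq_nm !inE eqxx.
have : m \in edge j n by rewrite eq_nm !inE eqxx.
rewrite !inE => /orP[/eqP->//|/eqP m_n] /orP[/eqP->//|/eqP n_m].
have /eqP := n_m; rewrite m_n -addrA -mulr2n -subr_eq0 opprD addrA subrr add0r.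
by rewrite oppr_eq0 (negbTE (unit_vec_neq0 j (isT : 0 < 2)%N)).
Qed.

Lemma diam_edge (d : nat) (j : 'I_d) n : diam_le 1 (edge j n).
Proof.
have nn' := adjacent_unit_vec n j.
move=> k l; rewrite !inE => /orP[]/eqP-> /orP[]/eqP->.
- by exists [::].
- by exists [:: n + unit_vec j]; split=> //=; rewrite nn'.
- by exists [:: n]; split=> //=; rewrite adjacent_sym nn'.
- by exists [::].
Qed.

(** The lower end n of the edge is recovered from the domain of the pattern, by
    [edge_inj]; w n receives the values at n and at the upper end. *)
Definition edge_interaction (R : realType) (d : nat) (A : choiceType)
    (j : 'I_d) (w : site d -> A -> A -> R) (a : {fmap site d -> A}) : R :=
  if [pick n : domf a | domf a == edge j (val n)] is Some n then
    if a.[? (val n + unit_vec j)%R]%fmap is Some b then w (val n) (a n) b else 0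
  else 0.

Lemma edge_interaction0 (R : realType) (d : nat) (A : choiceType) (j : 'I_d)
    (w : site d -> A -> A -> R) (a : {fmap site d -> A}) :
  (forall n, domf a <> edge j n) -> edge_interaction j w a = 0.
Proof.
move=> not_edge; rewrite /edge_interaction.
by case: pickP => // n /eqP /not_edge.
Qed.

Lemma edge_interaction_edge (R : realType) (d : nat) (A : choiceType)
    (j : 'I_d) (w : site d -> A -> A -> R) x n :
  edge_interaction j w (restrict x (edge j n)) = w n (x n) (x (n + unit_vec j)).
Proof.
have nE : n \in edge j n by rewrite !inE eqxx.
have n'E : n + unit_vec j \in edge j n by rewrite !inE eqxx orbT.
rewrite /edge_interaction; case: pickP => [m /eqP /edge_inj n_m|].
  rewrite -n_m (in_fnd (f := restrict x (edge j n)) n'E) !ffunE /=.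
  by rewrite -[fsval m]n_m.
by move=> /(_ [` nE]%fset) /=; rewrite eqxx.
Qed.

Lemma edge_interaction_nn (R : realType) (d : nat) (A : choiceType)
    (X : set (site d -> A)) (j : 'I_d) (w : site d -> A -> A -> R) :
  nn_interaction X (edge_interaction j w).
Proof.
move=> a _ not_diam; apply: edge_interaction0 => n eq_a.
by apply: not_diam; rewrite eq_a; apply: diam_edge.
Qed.

(** Only the edges in direction j that contain n can change their pattern. *)
Lemma gibbs_edge_interaction (R : realType) (d : nat) (A : choiceType)
    (j : 'I_d) (w : site d -> A -> A -> R) x y n :
    agree_on (~` [set n]) x y ->
  gibbs_cocycle (edge_interaction j w) (x, y) =
    (w (n - unit_vec j) (y (n - unit_vec j)) (y n)
     - w (n - unit_vec j) (x (n - unit_vec j)) (x n)) +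
    (w n (y n) (y (n + unit_vec j)) - w n (x n) (x (n + unit_vec j))).
Proof.
move=> xy; rewrite /gibbs_cocycle /=.
rewrite (@fsbigTE _ _ _ _ [fset edge j (n - unit_vec j)%R; edge j n]%fset).
  rewrite big_fsetU1 /=; last first.
    rewrite inE; apply/eqP => /edge_inj /eqP; rewrite -subr_eq0 addrAC subrr.
    by rewrite add0r oppr_eq0 -[unit_vec j]mulr1n (negbTE (unit_vec_neq0 _ _)).
  by rewrite big_seq_fset1 !edge_interaction_edge subrK.
move=> W; rewrite !inE negb_or => /andP[/eqP W_pred /eqP W_n].
have [[m Wm]|not_edge] := pselect (exists m, W = edge j m); last first.
  by rewrite !edge_interaction0 ?subrr // => m /= Wm; apply: not_edge; exists m.
rewrite (restrict_agree (x := y) (y := x)) ?subrr // => k /= kW.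
apply/esym/xy => /= kn; move: kW; rewrite {}kn Wm !inE.
case/orP=> /eqP n_m; first by apply: W_n; rewrite n_m.
by apply: W_pred; rewrite n_m addrK.
Qed.

Definition antidiff (R : zmodType) (f : int -> R) (t : int) : R :=
  match t with
  | Posz n => - \sum_(i < n) f i.+1
  | Negz n => \sum_(i < n.+1) f (- i%:Z)
  end.

Lemma antidiffE (R : zmodType) (f : int -> R) t :
  antidiff f (t - 1) - antidiff f t = f t.
Proof.
case: t => [[|n]|n].
- by rewrite -[0%N%:Z - 1]/(Negz 0) /= big_ord0 big_ord1 opprK addr0.
- have -> : n.+1%:Z - 1 = n by lia.
  by rewrite /= opprK big_ord_recr /= addKr.
- have -> : Negz n - 1 = Negz n.+1 by lia.
  by rewrite /= big_ord_recr /= addrAC subrr add0r NegzE.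
Qed.

(** The points (n - s e, a + s) with s an integer form a diagonal, on which the
    equation prescribes the increments of u; u is their antidifference, with the
    j-th coordinate of the site as the summation variable. *)
Lemma edge_potential (R : zmodType) (d : nat) (j : 'I_d) (A : pzRingType)
    (c : site d -> A -> R) :
  exists u : site d -> A -> R, forall n a,
    u (n - unit_vec j) a - u n (a - 1) = c n a.
Proof.
(* The increments along the diagonal through (n, v), indexed by the j-th
   coordinate; the function is the same for (n, v) and (n - e, v + 1), and the
   shift by 1 aligns it with the pair (n, a - 1) of the equation. *)
pose diag (n : site d) (v : A) (s : int) : R :=
  c (n + (s - n 0 j) *: unit_vec j) (v + (n 0 j - s + 1)%:~R).
exists (fun n v => antidiff (diag n v) (n 0 j)) => n a.
have -> : diag (n - unit_vec j) a = diag n (a - 1).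
  apply/funext => s; rewrite /diag !mxE !eqxx /=; congr c.
    have -> : s - (n 0 j - 1) = s - n 0 j + 1 by ring.
    by rewrite scalerDl scale1r addrCA subrK addrC.
  have -> : n 0 j - 1 - s + 1 = - 1 + (n 0 j - s + 1) by ring.
  by rewrite rmorphD rmorphN addrA.
have -> : (n - unit_vec j) 0 j = n 0 j - 1 by rewrite !mxE !eqxx.
by rewrite antidiffE /diag subrr scale0r addr0 add0r subrK.
Qed.

Definition pivot_pair (d : nat) (A : pzRingType) (X : set (site d -> A))
    (n : site d) (a : A) (x y : site d -> A) : Prop :=
  [/\ X x, X y, x n = a - 1 /\ y n = a + 1, forall k, adjacent n k -> x k = a
    & agree_on (~` [set n]) x y].

Lemma Delta_agree_off1 (d : nat) (A : choiceType) (X : set (site d -> A)) x y n :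
  X x -> X y -> agree_on (~` [set n]) x y -> Delta X (x, y).
Proof.
move=> Xx Xy xy; split=> //=.
by apply: sub_finite_set (finite_set1 n) => k /= neq; apply: contrapT => /xy.
Qed.

(** For F = {n} the boundary of F carries only the value a, so that n and a
    determine both configurations on F and its boundary. *)
Lemma pivot_value (R : realType) (d r : nat) (X : set (site d -> 'Z_r)) M n a :
    @markov_cocycle R _ _ X M ->
  exists t : R, forall x y, pivot_pair X n a x y -> M (x, y) = t.
Proof.
move=> [_ markovM].
have [[x0 [y0 [Xx0 Xy0 [x0n y0n] x0a xy0]]]|none] :=
  pselect (exists x y, pivot_pair X n a x y); last first.
  by exists 0 => x y xy; case: none; exists x, y.
exists (M (x0, y0)) => x y [Xx Xy [xn yn] xa xy].
have off1 z z' : agree_on (~` [set n]) z z' -> agree_on (~` [set` [fset n]%fset]) z z'.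
  by move=> zz' k /= kn; apply: zz' => /= k_n; apply: kn; rewrite inE k_n.
have nbr k : ([set` [fset n]%fset] `|` boundary [fset n]%fset) k ->
    k = n \/ k <> n /\ adjacent n k.
  case=> [|[]] /=; rewrite inE; first by move=> /eqP; left.
  by move=> /eqP kn [m]; rewrite inE => /eqP-> nk; right.
apply: (markovM [fset n]%fset); try exact: off1.
- exact: Delta_agree_off1 xy.
- exact: Delta_agree_off1 xy0.
- by move=> k /nbr[->|[kn nk]]; [rewrite xn x0n | rewrite xa ?x0a].
- move=> k /nbr[->|[kn nk]]; first by rewrite yn y0n.
  by rewrite -xy // -xy0 // xa ?x0a.
Qed.

Lemma raise_pivot_pair (d r : nat) (h : site d -> int) n :
    height_functions h -> (forall k, adjacent n k -> h k = h n + 1) ->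
  pivot_pair (@Xspace d r) n (h n + 1)%:~R (reduce r h) (reduce r (raise h n)).
Proof.
move=> hh pivot; split.
- by exists h.
- by exists (raise h n) => //; apply: raise_height.
- rewrite /reduce /raise eqxx; split.
    by rewrite rmorphD addrK.
  by rewrite -(rmorphD _ _ 1) -addrA.
- by move=> k /pivot; rewrite /reduce => ->.
- by move=> k /= /eqP kn; rewrite /reduce /raise (negbTE kn).
Qed.

Theorem proposition5p5 (R : realType) (d r : nat)
    (hd : (2 <= d)%N) (r_gt0 : (0 < r)%N) (hr : r \notin [:: 1; 2; 4]%N)
    (M : (site d -> 'Z_r) * (site d -> 'Z_r) -> R) :
  markov_cocycle (@Xspace d r) M <->
  exists phi : {fmap site d -> 'Z_r} -> R,
    nn_interaction (@Xspace d r) phi /\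
    forall xy, Delta (@Xspace d r) xy -> M xy = gibbs_cocycle phi xy.
Proof.
have r2 : (2 < r)%N by move: hr r_gt0; rewrite !inE; lia.
set X := @Xspace d r.
split=> [markovM|[phi [nn M_phi]]]; last first.
  have [cocycle_phi markov_phi] := gibbs_markov nn.
  split=> [x y z xy yz|F x y x' y' xy xy' *].
    rewrite !M_phi //; first exact: cocycle_phi.
    exact: Delta_trans xy yz.
  by rewrite !M_phi //; apply: (markov_phi F).
have [c cP] : exists c : site d -> 'Z_r -> R,
    forall n a x y, pivot_pair X n a x y -> M (x, y) = c n a.
  have [c cP] := choice (fun na => pivot_value na.1 na.2 markovM).
  by exists (fun n a => c (n, a)) => n a; apply: (cP (n, a)).
pose j := Ordinal (ltnW hd).
have [u uP] := edge_potential j c.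
pose phi : {fmap site d -> 'Z_r} -> R :=
  edge_interaction j (fun n a b => if b == a + 1 then u n a else 0).
have nn : nn_interaction X phi by apply: edge_interaction_nn.
exists phi; split=> // -[x y].
have [cocycleM _] := markovM; have [cocycle_phi _] := gibbs_markov nn.
have phi_pivot n a x' y' :
    pivot_pair X n a x' y' -> gibbs_cocycle phi (x', y') = c n a.
  case=> _ _ [xn yn] xa xy'; rewrite (gibbs_edge_interaction _ _ xy') xn yn.
  have pred_n : adjacent n (n - unit_vec j).
    by rewrite adjacent_sym -[X in adjacent _ X](subrK (unit_vec j)) adjacent_unit_vec.
  have n_succ := adjacent_unit_vec n j.
  have off k : adjacent n k -> y' k = a.
    by move=> nk; rewrite -xy' ?xa // => /= k_n; rewrite k_n adjacentxx in nk.
  rewrite !off // !xa // eqxx subrK eqxx -uP.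
  have two := negbTE (two_neq0 r2).
  rewrite (_ : (a - 1 == a + 1) = false); last first.
    by rewrite eq_sym -subr_eq0 opprB addrC addrA subrK two.
  rewrite (_ : (a == a + 1 + 1) = false); last first.
    by rewrite eq_sym -subr_eq0 -(addrA a) addrAC subrr add0r two.
  by rewrite subr0 sub0r.
move=> [/= [h hh <-] [g hg <-] fin].
have [g' [hg' <- fin']] := lift_pair hd r2 hh hg fin.
pose P h g := Delta X (reduce r h, reduce r g) /\
  M (reduce r h, reduce r g) = gibbs_cocycle phi (reduce r h, reduce r g).
suff [] : P h g' by [].
apply: pivot_induction => // {h hh g hg fin g' hg' fin'}.
- move=> h hh.
  have hhD : Delta X (reduce r h, reduce r h).
    by apply: (@Delta_agree_off1 _ _ _ _ _ 0) => //; exists h.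
  by split; rewrite // (cocycle_refl cocycleM) // (cocycle_refl cocycle_phi).
- move=> h g [hg eq_hg]; split; first exact: Delta_sym.
  by rewrite (cocycle_sym cocycleM hg) (cocycle_sym cocycle_phi hg) eq_hg.
- move=> h g f [hg eq_hg] [gf eq_gf]; split; first exact: Delta_trans hg gf.
  by rewrite (cocycleM _ _ _ hg gf) (cocycle_phi _ _ _ hg gf) eq_hg eq_gf.
- move=> h n hh pivot; have pair := raise_pivot_pair r hh pivot.
  split; last by rewrite (cP _ _ _ _ pair) (phi_pivot _ _ _ _ pair).
  by case: pair => Xh Xh' _ _; apply: Delta_agree_off1.
Qed.
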